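(* Let $R$ be a commutative ring with identity and let $\{a_n\}_{n\ge 0}$ be a sequence of elements of $R$. The double sequence $\{\boldsymbol{a}_n^{(k)}\}_{n,k\ge 0}$, defined by $\boldsymbol{a}_0^{(k)}=a_0^k\binom{k}{0}$ and $\boldsymbol{a}_m^{(k)}=\sum_{p=1}^{m}L(m,p)\,a_0^{k-p}\binom{k}{p}$ for $m\ge 1$, satisfies, for all nonnegative integers $m$ and $k$, the recursive formula $$\boldsymbol{a}_{m+1}^{(k)}=a_{m+1}\widehat{\boldsymbol{a}}_0^{(k)}+\cdots+a_{i+1}\widehat{\boldsymbol{a}}_{m-i}^{(k)}+\cdots+a_1\widehat{\boldsymbol{a}}_m^{(k)}=\sum_{i=0}^{m}a_{i+1}\widehat{\boldsymbol{a}}_{m-i}^{(k)},$$ where $\widehat{\boldsymbol{a}}_n^{(k)}$ is the transform of $\boldsymbol{a}_n^{(k)}$ obtained by replacing the integer $p$ in each $a_0^{k-p}\binom{k}{p}$ by $p+1$; that is, $\widehat{\boldsymbol{a}}_0^{(k)}=a_0^{k-1}\binom{k}{1}$ and $\widehat{\boldsymbol{a}}_m^{(k)}=\sum_{p=1}^{m}L(m,p)\,a_0^{k-p-1}\binom{k}{p+1}$ for $m\ge 1$.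
   Context: $\mathbb{N}$ denotes the nonnegative integers. For integers $1\le p\le m$, $\Delta(m,p)$ is the set of all $(k_1,\ldots,k_m)\in\mathbb{N}^m$ with $k_1+\cdots+k_m=p$ and $k_1+2k_2+\cdots+mk_m=m$, and $$L(m,p)=\sum_{(k_1,\ldots,k_m)\in\Delta(m,p)}\binom{p}{k_1,\ldots,k_m}a_1^{k_1}\cdots a_m^{k_m},$$ where $\binom{p}{k_1,\ldots,k_m}=\frac{p!}{k_1!\cdots k_m!}$ is the multinomial coefficient. Convention: for any $a\in R$ and nonnegative integers $k\le p$, the expression $a^{k-p}\binom{k}{p}$ means $\delta_{k,p}$, i.e. $1$ if $k=p$ and $0$ if $k<p$ (even when $a$ is not a unit). Also $a^0=1$ for all $a\in R$. The replacement of $p$ by $p+1$ is performed on the formal expression given by the defining formula (the quantities $a_0^{k-p}\binom{k}{p}$ being treated as formal symbols), which yields the explicit formulas for $\widehat{\boldsymbol{a}}_n^{(k)}$ stated in the claim. *)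

(* Defs.v *)
From mathcomp Require Import all_boot all_order all_algebra.

Set Implicit Arguments.
Unset Strict Implicit.
Unset Printing Implicit Defensive.

Import GRing.Theory.
Local Open Scope ring_scope.

(* Tuples are indexed from 0: the value at i : 'I_m is the entry k_(i+1).
   The condition k_1 + ... + k_m = p forces every entry to be at most p, so
   taking entries in 'I_p.+1 rather than nat loses nothing and makes the set
   finite. *)
Definition Delta (m p : nat) : {set {ffun 'I_m -> 'I_p.+1}} :=
  [set k : {ffun 'I_m -> 'I_p.+1} |
    ((\sum_(i < m) k i)%N == p) && ((\sum_(i < m) i.+1 * k i)%N == m)].

(* The division is exact whenever the entries of k sum to p. *)
Definition multinomial (m p : nat) (k : {ffun 'I_m -> 'I_p.+1}) : nat :=
  (p`! %/ \prod_(i < m) (k i)`!)%N.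

Definition L (R : comPzRingType) (a : nat -> R) (m p : nat) : R :=
  \sum_(k in Delta m p) (\prod_(i < m) a i.+1 ^+ k i) *+ multinomial k.

(* The symbol x^(k-p) binom(k,p), which by convention is the Kronecker delta
   of k and p when k <= p, even if x is not invertible. *)
Definition powbin (R : comPzRingType) (x : R) (k p : nat) : R :=
  if (k <= p)%N then (k == p)%:R else x ^+ (k - p) *+ 'C(k, p).

Definition bold (R : comPzRingType) (a : nat -> R) (m k : nat) : R :=
  if m is 0%N then powbin (a 0%N) k 0
  else \sum_(1 <= p < m.+1) L a m p * powbin (a 0%N) k p.

(* [bold] with p replaced by p + 1 in each symbol powbin (a 0) k p; the
   factors L a m p are left unchanged. *)
Definition boldhat (R : comPzRingType) (a : nat -> R) (m k : nat) : R :=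
  if m is 0%N then powbin (a 0%N) k 1
  else \sum_(1 <= p < m.+1) L a m p * powbin (a 0%N) k p.+1.

(* Main.v *)
(* L(m, p) is the coefficient of X^m in (a_1 X + a_2 X^2 + ...)^p, so that
   L(m+1, p+1) = sum_i a_(i+1) L(m-i, p).  This is obtained directly from the
   Pascal rule for multinomial coefficients, by removing one from a nonzero
   entry of the exponent vector.  The theorem is the resulting identity
   between the coefficients of each symbol a_0^(k-p-1) binom(k, p+1). *)
Require Import Defs.
From mathcomp Require Import all_boot all_order all_algebra.

Set Implicit Arguments.
Unset Strict Implicit.
Unset Printing Implicit Defensive.

Import GRing.Theory.
Local Open Scope ring_scope.

(** The two-term case is integrality of a binomial coefficient; the general case follows by adding
    one term at a time. *)
Lemma dvdn_prod_fact (I : finType) (k : I -> nat) :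
  (\prod_i (k i)`! %| (\sum_i k i)`!)%N.
Proof.
apply: (big_ind2 (fun x y => y %| x`!)%N) => // x1 y1 x2 y2 dv1 dv2.
have := bin_fact (leq_addr x2 x1); rewrite addKn => <-.
exact/dvdn_mull/dvdn_mul.
Qed.

Lemma multinomial_pascal (I : finType) (k : I -> nat) (p : nat) :
  (\sum_i k i)%N = p.+1 ->
  (p.+1`! %/ \prod_i (k i)`!)%N =
  (\sum_(j | 0 < k j) p`! %/ \prod_i (k i - (i == j))`!)%N.
Proof.
move=> sumk.
have prod_gt0 : (0 < \prod_i (k i)`!)%N.
  by apply: prodn_gt0 => i; apply: fact_gt0.
apply/eqP; rewrite -(eqn_pmul2r prod_gt0) divnK; last first.
  by rewrite -sumk dvdn_prod_fact.
rewrite big_distrl factS -{1}sumk big_distrl /=; apply/eqP.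
rewrite (bigID (fun j => 0 < k j)%N) /= [X in (_ + X)%N]big1 ?addn0; last first.
  by move=> j; rewrite lt0n negbK => /eqP->.
apply: eq_bigr => j kj_gt0.
have -> : (\prod_i (k i)`! = k j * \prod_i (k i - (i == j))`!)%N.
  rewrite (bigD1 j) //= [in RHS](bigD1 j) //= eqxx subn1 mulnA; congr (_ * _)%N.
    by case: (k j) kj_gt0.
  by apply: eq_bigr => i /negPf ->; rewrite subn0.
rewrite mulnCA divnK //.
have <- : (\sum_i (k i - (i == j)) = p)%N; last exact: dvdn_prod_fact.
apply/eqP; rewrite -eqSS -sumk (bigD1 j) //= [in X in _ == X](bigD1 j) //=.
rewrite eqxx subn1 -addSn prednK //; apply/eqP; congr (_ + _)%N.
by apply: eq_bigr => i /negPf ->; rewrite subn0.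
Qed.

Lemma big_ord_support (S : Type) (idx : S) (op : Monoid.law idx)
    (G : nat -> S) (m n : nat) :
  (m <= n)%N -> (forall i, (m <= i)%N -> G i = idx) ->
  \big[op/idx]_(i < n) G i = \big[op/idx]_(0 <= i < m) G i.
Proof.
move=> lemn G_out.
rewrite -(big_mkord xpredT G) (big_cat_nat (leq0n m) lemn) /=.
rewrite [X in op _ X]big_nat_cond [X in op _ X]big1 ?Monoid.mulm1 // => i.
by case/andP=> /andP[lemi _] _; apply: G_out.
Qed.

Definition Delta_box (N B m p : nat) (k : {ffun 'I_N -> 'I_B.+1}) : bool :=
  ((\sum_(i < N) k i)%N == p) && ((\sum_(i < N) i.+1 * k i)%N == m).

(* [L a m p] with the dimension and the range of the exponent vectors decoupled
   from [m] and [p]: the recursion compares vectors of different shapes. *)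
Definition Lbox (R : comPzRingType) (a : nat -> R) (N B m p : nat) : R :=
  \sum_(k : {ffun 'I_N -> 'I_B.+1} | Delta_box m p k)
     (\prod_(i < N) a i.+1 ^+ k i) *+ (p`! %/ \prod_(i < N) (k i)`!).

Lemma LE (R : comPzRingType) (a : nat -> R) (m p : nat) :
  L a m p = Lbox a m p m p.
Proof. by apply: eq_bigl => k; rewrite inE. Qed.

Section Resize.

(** Extension by zero to all of [nat], so that vectors of different shapes can be compared. *)
Definition entry (N B : nat) (k : {ffun 'I_N -> 'I_B.+1}) (n : nat) : nat :=
  if insub n is Some i then k i else 0%N.

Definition resize (N B N' B' : nat) (k : {ffun 'I_N -> 'I_B.+1}) :
    {ffun 'I_N' -> 'I_B'.+1} := [ffun i : 'I_N' => inord (entry k i)].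

Lemma entry_ord (N B : nat) (k : {ffun 'I_N -> 'I_B.+1}) (i : 'I_N) :
  entry k i = k i.
Proof. by rewrite /entry valK. Qed.

Lemma entry_default (N B n : nat) (k : {ffun 'I_N -> 'I_B.+1}) :
  (N <= n)%N -> entry k n = 0%N.
Proof. by move=> leNn; rewrite /entry insubF // ltnNge leNn. Qed.

Variables (N B m p : nat).
Implicit Type k : {ffun 'I_N -> 'I_B.+1}.

Lemma entry_le k n : Delta_box m p k -> (entry k n <= p)%N.
Proof.
case/andP=> /eqP <- _; have [ltnN|/entry_default->//] := ltnP n N.
by rewrite (entry_ord k (Ordinal ltnN)) (bigD1 (Ordinal ltnN)) ?leq_addr.
Qed.

(** Position [n] has weight [n.+1], so a nonzero entry there would push the weighted sum above
    [m]. *)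
Lemma entry_eq0 k n : Delta_box m p k -> (m <= n)%N -> entry k n = 0%N.
Proof.
case/andP=> _ /eqP <-; have [ltnN|/entry_default->//] := ltnP n N.
rewrite (entry_ord k (Ordinal ltnN)) (bigD1 (Ordinal ltnN)) //=.
case: (nat_of_ord (k _)) => // c /(leq_trans (leq_addr _ _)).
by rewrite mulnS => /(leq_trans (leq_addr _ _)); rewrite ltnn.
Qed.

Variables (N' B' : nat).
Hypotheses (lemN : (m <= N)%N) (lemN' : (m <= N')%N).
Hypotheses (lepB : (p <= B)%N) (lepB' : (p <= B')%N).

(** Nothing is lost: entries are at most [p], so [inord] does not overflow, and the positions cut
    off are at least [m], hence hold zeros. *)
Lemma entry_resize k n :
  Delta_box m p k -> entry (resize N' B' k) n = entry k n.
Proof.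
move=> kP; have [ltnN|leNn] := ltnP n N'.
  rewrite (entry_ord _ (Ordinal ltnN)) ffunE inordK // ltnS.
  exact: leq_trans (entry_le _ kP) lepB'.
by rewrite entry_default // (entry_eq0 kP) // (leq_trans lemN').
Qed.

(** Padding zeros contribute [idx], so both sides reduce to the positions below [m]. It serves for
    the two constraints, the monomial and the product of factorials alike. *)
Lemma big_resize k (S : Type) (idx : S) (op : Monoid.law idx)
    (G : nat -> nat -> S) :
  Delta_box m p k -> (forall i, G i 0%N = idx) ->
  \big[op/idx]_(i < N') G i (resize N' B' k i) = \big[op/idx]_(i < N) G i (k i).
Proof.
move=> kP G0.
under [LHS]eq_bigr do rewrite -entry_ord entry_resize //.
under [RHS]eq_bigr do rewrite -entry_ord.
have G_out i : (m <= i)%N -> G i (entry k i) = idx.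
  by move/(entry_eq0 kP) ->; apply: G0.
by rewrite (big_ord_support op lemN' G_out) (big_ord_support op lemN G_out).
Qed.

Lemma Delta_box_resize k :
  Delta_box m p k -> Delta_box m p (resize N' B' k).
Proof.
move=> kP; rewrite /Delta_box (big_resize _ (G := fun _ c => c) kP) //.
rewrite (big_resize _ (G := fun i c => i.+1 * c)%N kP) // => i.
by rewrite muln0.
Qed.

Lemma resizeK k : Delta_box m p k -> resize N B (resize N' B' k) = k.
Proof.
move=> kP; apply/ffunP=> i; apply: val_inj.
by rewrite ffunE entry_resize // entry_ord inord_val.
Qed.

End Resize.

Lemma Lbox_resize (R : comPzRingType) (a : nat -> R) (N B N' B' m p : nat) :
  (m <= N)%N -> (m <= N')%N -> (p <= B)%N -> (p <= B')%N ->
  Lbox a N B m p = Lbox a N' B' m p.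
Proof.
move=> lemN lemN' lepB lepB'; rewrite /Lbox.
rewrite (reindex_onto (@resize N' B' N B) (@resize N B N' B')); last first.
  by move=> k; apply: resizeK.
apply: eq_big => [k|k /andP[rkP /eqP rrk]].
  apply/andP/idP=> [[rkP /eqP <-]|kP]; first exact: Delta_box_resize.
  rewrite Delta_box_resize //; split=> //.
  by apply/eqP/(resizeK (m := m) (p := p)).
(* The reindexing constrains only the resized vector; the constraint on [k] comes back through the
   round trip. *)
have kP : Delta_box m p k by rewrite -rrk Delta_box_resize.
rewrite (big_resize lemN' lemN lepB _ (G := fun i c => a i.+1 ^+ c) kP) //.
by rewrite (big_resize lemN' lemN lepB _ (G := fun i c => c`!) kP).
Qed.

Section Shift.

Variables (N B : nat) (j : 'I_N).
Implicit Type k : {ffun 'I_N -> 'I_B.+1}.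

Definition incr k : {ffun 'I_N -> 'I_B.+1} :=
  [ffun i => inord (k i + (i == j))].
Definition decr k : {ffun 'I_N -> 'I_B.+1} :=
  [ffun i => inord (k i - (i == j))].

Lemma incrE k i : (k j < B)%N -> incr k i = (k i + (i == j))%N :> nat.
Proof.
move=> ltkB; rewrite ffunE inordK //.
by have [->|_] := eqVneq i j; rewrite ?addn1 ?addn0.
Qed.

Lemma decrE k i : decr k i = (k i - (i == j))%N :> nat.
Proof. by rewrite ffunE inordK // ltnS (leq_trans (leq_subr _ _)) // -ltnS. Qed.

Lemma incrK k : (k j < B)%N -> decr (incr k) = k.
Proof.
move=> ltkB; apply/ffunP=> i; apply: val_inj.
by rewrite /= decrE incrE // addnK.
Qed.

Lemma decrK k : (0 < k j)%N -> incr (decr k) = k.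
Proof.
move=> k_gt0; apply/ffunP=> i; apply: val_inj; rewrite /= incrE.
  by rewrite decrE; have [->|_] := eqVneq i j; rewrite ?subnK ?subn0 ?addn0.
by rewrite decrE eqxx subn1; case: (nat_of_ord _) k_gt0 (ltn_ord (k j)).
Qed.

(** On overflow [inord] falls back to 0, so a positive entry at [j] certifies that the increment was
    genuine. *)
Lemma incr_gt0 k : (0 < incr k j)%N = (k j < B)%N.
Proof.
have [ltkB|] := ltnP (k j) B; first by rewrite incrE // eqxx addn1.
move=> leBk; rewrite ffunE eqxx addn1 /inord val_insubd ltnS.
by rewrite [(k j < B)%N]ltnNge leBk.
Qed.

Lemma Delta_box_incr k m p : (k j < B)%N -> (j <= m)%N ->
  Delta_box m.+1 p.+1 (incr k) = Delta_box (m - j) p k.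
Proof.
move=> ltkB lejm; rewrite /Delta_box.
have -> : (\sum_(i < N) incr k i = (\sum_(i < N) k i).+1)%N.
  rewrite (bigD1 j) //= [in RHS](bigD1 j) //= incrE // eqxx addn1 addSn.
  by congr (_ + _).+1; apply: eq_bigr => i /negPf ij; rewrite incrE // ij addn0.
have -> : (\sum_(i < N) i.+1 * incr k i = \sum_(i < N) i.+1 * k i + j.+1)%N.
  rewrite (bigD1 j) //= [in RHS](bigD1 j) //= incrE // eqxx addn1 mulnSr.
  rewrite addnAC; congr (_ + _ + _)%N.
  by apply: eq_bigr => i /negPf ij; rewrite incrE // ij addn0.
by rewrite eqSS -(eqn_add2r j.+1 _ (m - j)) [(m - j + _)%N]addnS subnK.
Qed.

End Shift.

Lemma Lbox_rec (R : comPzRingType) (a : nat -> R) (B m p : nat) : (p < B)%N ->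
  Lbox a m.+1 B m.+1 p.+1 = \sum_(j < m.+1) a j.+1 * Lbox a m.+1 B (m - j) p.
Proof.
move=> ltpB; rewrite /Lbox.
under eq_bigr => k /andP[/eqP sumk _].
  rewrite (multinomial_pascal sumk) -sumrMnr; over.
rewrite (exchange_big_dep xpredT) //=; apply: eq_bigr => j _.
(* For fixed [j], the vectors with positive entry at [j] are the increments of those for
   [(m - j, p)]; the added unit supplies the factor [a j.+1]. *)
rewrite big_distrr (reindex_onto (incr j) (decr j)) /=; last first.
  by move=> k /andP[_]; apply: decrK.
have lejm : (j <= m)%N by rewrite -ltnS.
apply: eq_big => [k|k].
  rewrite incr_gt0; have [ltkB|leBk] := ltnP (k j) B.
    by rewrite Delta_box_incr // incrK // eqxx !andbT.
  (* Entries of a vector of total [p] are at most [p < B], so overflow never occurs on the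
     right-hand side. *)
  rewrite andbF; apply/esym/(contraTF _ leBk) => kP.
  by rewrite -ltnNge -entry_ord (leq_ltn_trans (entry_le _ kP)).
rewrite incr_gt0 => /andP[/andP[_ ltkB] _].
rewrite mulrnAr; congr (_ *+ (_ %/ _)).
  rewrite (bigD1 j) //= [in RHS](bigD1 j) //= incrE // eqxx addn1 exprS -mulrA.
  do 2!congr (_ * _).
  by apply: eq_bigr => i /negPf ij; rewrite incrE // ij addn0.
by apply: eq_bigr => i _; rewrite incrE // addnK.
Qed.

(** The recursion is taken inside the box of shape [(m.+1, p.+1)], after which each term is moved to
    its own box [(m - j, p)]. *)
Lemma L_rec (R : comPzRingType) (a : nat -> R) (m p : nat) :
  L a m.+1 p.+1 = \sum_(j < m.+1) a j.+1 * L a (m - j) p.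
Proof.
rewrite LE Lbox_rec //; apply: eq_bigr => j _; congr (_ * _); rewrite LE.
by apply: Lbox_resize; rewrite // (leq_trans (leq_subr _ _)).
Qed.

(** All weights are at least 1, so no admissible vector exists and the sum is empty. *)
Lemma L_out (R : comPzRingType) (a : nat -> R) (m p : nat) :
  (m < p)%N -> L a m p = 0.
Proof.
move=> ltmp; apply: big1 => k; rewrite inE => /andP[/eqP sumk /eqP wsumk].
suff: (\sum_(i < m) k i <= \sum_(i < m) i.+1 * k i)%N.
  by rewrite sumk wsumk leqNgt ltmp.
by apply: leq_sum => i _; rewrite leq_pmull.
Qed.

Lemma L_0 (R : comPzRingType) (a : nat -> R) (m : nat) :
  L a m 0 = (m == 0%N)%:R.
Proof.
case: m => [|m].
  rewrite LE /Lbox (big_pred1 [ffun=> ord0]) => [|k].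
    by rewrite !big_ord0.
  by rewrite /Delta_box !big_ord0 !eqxx; apply/esym/eqP/ffunP=> -[].
apply: big1 => k; rewrite inE => /andP[_].
by rewrite big1 // => i _; rewrite (ord1 (k i)) muln0.
Qed.

(** Absorbs the case split on [n] and gives every transform the same range of [p]: the term at 0 is
    nonzero only for [n = 0], where it is the base case, and terms with [p > n] vanish by
    [L_out]. *)
Lemma boldhatE (R : comPzRingType) (a : nat -> R) (n m k : nat) : (n <= m)%N ->
  boldhat a n k = \sum_(p < m.+1) L a n p * powbin (a 0%N) k p.+1.
Proof.
move=> lenm.
rewrite -(big_mkord xpredT (fun p => L a n p * powbin (a 0%N) k p.+1)).
rewrite (big_cat_nat (n := n.+1)) //= [X in _ + X]big_nat_cond.
rewrite [X in _ + X]big1 ?addr0 => [|p /andP[/andP[ltnp _] _]]; last first.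
  by rewrite L_out // mul0r.
rewrite big_ltn // L_0; case: n lenm => [|n] _ /=.
  by rewrite big_geq // mul1r addr0.
by rewrite mul0r add0r.
Qed.

Theorem theorem3p2 (R : comPzRingType) (a : nat -> R) (m k : nat) :
  bold a m.+1 k = \sum_(i < m.+1) a i.+1 * boldhat a (m - i) k.
Proof.
under eq_bigr do rewrite (boldhatE _ _ (leq_subr _ m)) mulr_sumr.
(* The common range of [p] permits the exchange; shifting the index of [bold] by one then aligns the
   symbols [powbin (a 0%N) k p.+1], whose coefficients are compared. *)
rewrite exchange_big /= big_add1 /= big_mkord; apply: eq_bigr => p _.
by rewrite L_rec mulr_suml; apply: eq_bigr => i _; rewrite mulrA.
Qed.
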